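(* Let $r,\sigma$ be nonzero real constants, let $K_1,K_2,K_3,K_4\ge1$ be integers, let $m_k$ ($1\le k\le K_1$), $z_k$ ($1\le k\le K_2$), $w_k$ ($1\le k\le K_3$), $d_k$ ($1\le k\le K_4$) be arbitrary real numbers, and let $\mu_k,\zeta_k,\omega_k,\delta_k$ (same ranges of $k$ respectively) be elements of $\{0,-2,-4,-6,\dots\}$. Let $$\mathcal C(t,S)=\sum_{k=1}^{K_1}m_kC_{1,\mu_k}(t,S)+\sum_{k=1}^{K_2}z_kC_{2,\zeta_k}(t,S)+\sum_{k=1}^{K_3}w_kC_{3,\omega_k}(t,S)+\sum_{k=1}^{K_4}d_kC_{4,\delta_k}(t,S),$$ and $\Phi(t,S,C)=C-\mathcal C(t,S)$, so that $\Phi(t,S,C)=0$ is a solution of the Bachelier PDE $$ rS\,\frac{\partial C}{\partial S}+\frac12\sigma^2\frac{\partial^2 C}{\partial S^2}+\frac{\partial C}{\partial t}-rC=0. $$ Let $i\in\{1,\dots,6\}$ and suppose that for at least one of the functions $$\Omega\in\{C-C_{1,\mu_k}(t,S)\}_k\cup\{C-C_{2,\zeta_k}(t,S)\}_k\cup\{C-C_{3,\omega_k}(t,S)\}_k\cup\{C-C_{4,\delta_k}(t,S)\}_k$$ the function $\xi_i\Omega$ is different from zero (i.e. not identically zero) on the surface $\Omega=0$. Then the solution $\Phi(t,S,C)=0$ is mapped by the one-parameter Lie group of point symmetries $G_i$ (with parameter $\varepsilon_i$) of the Bachelier PDE to a one-parameter family (with parameter $\varepsilon_i$) of elementary function solutions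 of the Bachelier PDE (and not merely to itself), namely $\Phi(G_i(t),G_i(S),G_i(C))=0$, i.e. $G_i(C)=\mathcal C(G_i(t),G_i(S))$, i.e. $$G_i(C)=\sum_{k=1}^{K_1}m_kC_{1,\mu_k}(G_i(t),G_i(S))+\sum_{k=1}^{K_2}z_kC_{2,\zeta_k}(G_i(t),G_i(S))+\sum_{k=1}^{K_3}w_kC_{3,\omega_k}(G_i(t),G_i(S))+\sum_{k=1}^{K_4}d_kC_{4,\delta_k}(G_i(t),G_i(S)).$$
   Context: An equation $\Phi(t,S,C)=0$ is called a solution of the PDE when it determines $C$ as a function of $(t,S)$ that satisfies the PDE. $F(e,q;u)=\sum_{k=0}^\infty\frac{(e)_k}{(q)_k}\frac{u^k}{k!}$, with $(w)_k=w(w+1)\cdots(w+k-1)$, is Kummer's confluent hypergeometric function of the first kind; for $e=-m$ with $m$ a non-negative integer it is a polynomial in $u$ of degree $m$. For $n\in\{0,-2,-4,\dots\}$: $C_{1,n}(t,S)=S\,F\big(\tfrac n2,\tfrac32;-r(S/\sigma)^2\big)e^{nrt}$, $C_{2,n}(t,S)=F\big(\tfrac n2,\tfrac12;-r(S/\sigma)^2\big)e^{(n+1)rt}$, $C_{3,n}(t,S)=e^{-r(S/\sigma)^2}S\,F\big(\tfrac n2,\tfrac32;r(S/\sigma)^2\big)e^{-(n-3)rt}$, $C_{4,n}(t,S)=e^{-r(S/\sigma)^2}F\big(\tfrac n2,\tfrac12;r(S/\sigma)^2\big)e^{-(n-2)rt}$. The infinitesimal generators are $\xi_1=\partial_t$;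 $\xi_2=e^{rt}\partial_S$; $\xi_3=e^{-rt}\partial_S-\frac{2e^{-rt}rSC}{\sigma^2}\partial_C$; $\xi_4=-\frac{e^{-2rt}}{2r}\partial_t+\frac12e^{-2rt}S\,\partial_S-\frac{e^{-2rt}(\sigma^2+rS^2)C}{\sigma^2}\partial_C$; $\xi_5=\frac{e^{2rt}}{2r}\partial_t+\frac12e^{2rt}S\,\partial_S+\frac12e^{2rt}C\,\partial_C$; $\xi_6=C\,\partial_C$. The corresponding one-parameter groups of point symmetries $G_i:(t,S,C)\mapsto(G_i(t),G_i(S),G_i(C))$, with real parameters $\varepsilon_i$, are $G_1:(t+\varepsilon_1,\,S,\,C)$; $G_2:(t,\,S+\varepsilon_2e^{rt},\,C)$; $G_3:\Big(t,\,S+\varepsilon_3e^{-rt},\,e^{-\varepsilon_3re^{-rt}(\varepsilon_3e^{-rt}+2S)/\sigma^2}C\Big)$; $G_4:\left(\frac{\ln(e^{2rt}+\varepsilon_4)}{2r},\,\frac{e^{rt}S}{\sqrt{e^{2rt}+\varepsilon_4}},\,e^{-\frac{r\left(2\sigma^2t(e^{2rt}+\varepsilon_4)-\varepsilon_4S^2\right)}{\sigma^2(e^{2rt}+\varepsilon_4)}}(e^{2rt}+\varepsilon_4)C\right)$; $G_5:\left(-\frac{\ln(e^{-2rt}+\varepsilon_5)}{2r},\,\frac{e^{-rt}S}{\sqrt{e^{-2rt}+\varepsilon_5}},\,\frac{e^{-rt}C}{\sqrt{e^{-2rt}+\varepsilon_5}}\right)$; $G_6:(t,\,S,\,e^{\varepsilon_6}C)$.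 Here $G_4$ is considered where $e^{2rt}+\varepsilon_4>0$ and $G_5$ where $e^{-2rt}+\varepsilon_5>0$. ''Mapped by $G_i$ to a one-parameter family of solutions'' means that for each value of $\varepsilon_i$ the equation $\Phi(G_i(t),G_i(S),G_i(C))=0$, obtained by substituting $(G_i(t),G_i(S),G_i(C))$ for $(t,S,C)$ in $\Phi=0$, is a solution of the PDE, and that the solution is not mapped to itself. A solution $\Phi(t,S,C)=0$ is said to be mapped to itself by $G_i$ when $\Phi(G_i(t),G_i(S),G_i(C))=0\Leftrightarrow\Phi(t,S,C)=0$ (for all values of $\varepsilon_i$); in that case it is said not to be mapped to a one-parameter family.
   Formalization: ''Not merely to itself'' is asserted only when the function in Ω of the hypothesis has nonzero total coefficient in the sum after collecting equal indices; for arbitrary coefficients (e.g. all zero, i=6) that clause is false. *)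

(* Defs.v *)
(* Stdlib reals and Coquelicot. *)
From Stdlib Require Export Reals ZArith.
From Coquelicot Require Export Coquelicot.
Open Scope R_scope.

(* Throughout, [t] is time, [s] the price of the underlying and [c] the price
   of the option. *)

Definition nonpos_even (n : Z) : Prop := exists j : nat, n = (- 2 * Z.of_nat j)%Z.

Fixpoint poch (w : R) (k : nat) : R :=
  match k with
  | O => 1
  | S k' => poch w k' * (w + INR k')
  end.

Definition kummer (e q u : R) : R :=
  Series (fun k => poch e k / poch q k * (u ^ k / INR (fact k))).

Definition C1 (r sigma : R) (n : Z) (t s : R) : R :=
  s * kummer (IZR n / 2) (3 / 2) (- r * (s / sigma) ^ 2) * exp (IZR n * r * t).

Definition C2 (r sigma : R) (n : Z) (t s : R) : R :=
  kummer (IZR n / 2) (1 / 2) (- r * (s / sigma) ^ 2) * exp ((IZR n + 1) * r * t).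

Definition C3 (r sigma : R) (n : Z) (t s : R) : R :=
  exp (- r * (s / sigma) ^ 2) * s
  * kummer (IZR n / 2) (3 / 2) (r * (s / sigma) ^ 2) * exp (- (IZR n - 3) * r * t).

Definition C4 (r sigma : R) (n : Z) (t s : R) : R :=
  exp (- r * (s / sigma) ^ 2)
  * kummer (IZR n / 2) (1 / 2) (r * (s / sigma) ^ 2) * exp (- (IZR n - 2) * r * t).

Inductive symmetry : Set := sym1 | sym2 | sym3 | sym4 | sym5 | sym6.

(* The generator xi_i is xi_t d/dt + xi_s d/ds + xi_c d/dc. *)

Definition xi_t (r : R) (i : symmetry) (t : R) : R :=
  match i with
  | sym1 => 1
  | sym4 => - (exp (- 2 * r * t) / (2 * r))
  | sym5 => exp (2 * r * t) / (2 * r)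
  | sym2 | sym3 | sym6 => 0
  end.

Definition xi_s (r : R) (i : symmetry) (t s : R) : R :=
  match i with
  | sym2 => exp (r * t)
  | sym3 => exp (- r * t)
  | sym4 => 1 / 2 * exp (- 2 * r * t) * s
  | sym5 => 1 / 2 * exp (2 * r * t) * s
  | sym1 | sym6 => 0
  end.

Definition xi_c (r sigma : R) (i : symmetry) (t s c : R) : R :=
  match i with
  | sym3 => - (2 * exp (- r * t) * r * s * c / sigma ^ 2)
  | sym4 => - (exp (- 2 * r * t) * (sigma ^ 2 + r * s ^ 2) * c / sigma ^ 2)
  | sym5 => 1 / 2 * exp (2 * r * t) * c
  | sym6 => c
  | sym1 | sym2 => 0
  end.

(* [Derive] is total; it is only used here on differentiable [Omega]. *)
Definition xi_app (r sigma : R) (i : symmetry) (Omega : R -> R -> R -> R)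
    (t s c : R) : R :=
  xi_t r i t * Derive (fun t' => Omega t' s c) t
  + xi_s r i t s * Derive (fun s' => Omega t s' c) s
  + xi_c r sigma i t s c * Derive (fun c' => Omega t s c') c.

Definition xi_nonzero_on_surface (r sigma : R) (i : symmetry)
    (Omega : R -> R -> R -> R) : Prop :=
  exists t s c, Omega t s c = 0 /\ xi_app r sigma i Omega t s c <> 0.

(* The set of times at which the transformation of parameter [eps] is defined. *)
Definition G_dom (r : R) (i : symmetry) (eps : R) (t : R) : Prop :=
  match i with
  | sym4 => 0 < exp (2 * r * t) + eps
  | sym5 => 0 < exp (- 2 * r * t) + eps
  | sym1 | sym2 | sym3 | sym6 => True
  end.

Definition G_t (r : R) (i : symmetry) (eps : R) (t : R) : R :=
  match i with
  | sym1 => t + eps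
  | sym4 => ln (exp (2 * r * t) + eps) / (2 * r)
  | sym5 => - (ln (exp (- 2 * r * t) + eps) / (2 * r))
  | sym2 | sym3 | sym6 => t
  end.

Definition G_s (r : R) (i : symmetry) (eps : R) (t s : R) : R :=
  match i with
  | sym2 => s + eps * exp (r * t)
  | sym3 => s + eps * exp (- r * t)
  | sym4 => exp (r * t) * s / sqrt (exp (2 * r * t) + eps)
  | sym5 => exp (- r * t) * s / sqrt (exp (- 2 * r * t) + eps)
  | sym1 | sym6 => s
  end.

Definition G_c (r sigma : R) (i : symmetry) (eps : R) (t s c : R) : R :=
  match i with
  | sym1 | sym2 => c
  | sym3 =>
      exp (- (eps * r * exp (- r * t) * (eps * exp (- r * t) + 2 * s) / sigma ^ 2)) * c
  | sym4 =>
      exp (- (r * (2 * sigma ^ 2 * t * (exp (2 * r * t) + eps) - eps * s ^ 2)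
              / (sigma ^ 2 * (exp (2 * r * t) + eps))))
      * (exp (2 * r * t) + eps) * c
  | sym5 => exp (- r * t) * c / sqrt (exp (- 2 * r * t) + eps)
  | sym6 => exp eps * c
  end.

Definition transform (r sigma : R) (i : symmetry) (eps : R)
    (Phi : R -> R -> R -> R) : R -> R -> R -> R :=
  fun t s c => Phi (G_t r i eps t) (G_s r i eps t s) (G_c r sigma i eps t s c).

(* In the next definitions the equation is considered for the times [t] in [D]
   and for all real [s]. *)

Definition satisfies_bachelier (r sigma : R) (D : R -> Prop) (u : R -> R -> R) : Prop :=
  forall t s, D t ->
    ex_derive (fun t' => u t' s) t
    /\ locally s (fun s' => ex_derive (u t) s')
    /\ ex_derive (Derive (u t)) s
    /\ r * s * Derive (u t) s + 1 / 2 * sigma ^ 2 * Derive_n (u t) 2 s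
       + Derive (fun t' => u t' s) t - r * u t s = 0.

Definition determines (D : R -> Prop) (Phi : R -> R -> R -> R) (u : R -> R -> R) : Prop :=
  forall t s c, D t -> (Phi t s c = 0 <-> c = u t s).

Definition is_solution (r sigma : R) (D : R -> Prop) (Phi : R -> R -> R -> R) : Prop :=
  exists u, determines D Phi u /\ satisfies_bachelier r sigma D u.

(* Elementary functions of (t,s): generated by the constants and the two
   variables under the field operations, exp, ln, square root and the (inverse)
   trigonometric functions, each operation being applied only where it is
   defined. *)
Inductive elementary (D : R -> Prop) : (R -> R -> R) -> Prop :=
| el_const a : elementary D (fun _ _ => a)
| el_t : elementary D (fun t _ => t)
| el_s : elementary D (fun _ s => s)
| el_plus f g : elementary D f -> elementary D g ->
    elementary D (fun t s => f t s + g t s)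
| el_opp f : elementary D f -> elementary D (fun t s => - f t s)
| el_mult f g : elementary D f -> elementary D g ->
    elementary D (fun t s => f t s * g t s)
| el_inv f : elementary D f -> (forall t s, D t -> f t s <> 0) ->
    elementary D (fun t s => / f t s)
| el_exp f : elementary D f -> elementary D (fun t s => exp (f t s))
| el_ln f : elementary D f -> (forall t s, D t -> 0 < f t s) ->
    elementary D (fun t s => ln (f t s))
| el_sqrt f : elementary D f -> (forall t s, D t -> 0 <= f t s) ->
    elementary D (fun t s => sqrt (f t s))
| el_sin f : elementary D f -> elementary D (fun t s => sin (f t s))
| el_cos f : elementary D f -> elementary D (fun t s => cos (f t s))
| el_asin f : elementary D f -> (forall t s, D t -> -1 <= f t s <= 1) ->
    elementary D (fun t s => asin (f t s))
| el_atan f : elementary D f -> elementary D (fun t s => atan (f t s))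
| el_ext f g : elementary D f -> (forall t s, D t -> f t s = g t s) ->
    elementary D g.

Definition is_elementary_solution (r sigma : R) (D : R -> Prop)
    (Phi : R -> R -> R -> R) : Prop :=
  exists u, determines D Phi u /\ satisfies_bachelier r sigma D u /\ elementary D u.

Definition mapped_to_elementary_solutions (r sigma : R) (i : symmetry)
    (Phi : R -> R -> R -> R) : Prop :=
  forall eps,
    is_elementary_solution r sigma (G_dom r i eps) (transform r sigma i eps Phi).

Definition mapped_to_itself (r sigma : R) (i : symmetry)
    (Phi : R -> R -> R -> R) : Prop :=
  forall eps t s c, G_dom r i eps t ->
    (transform r sigma i eps Phi t s c = 0 <-> Phi t s c = 0).

Definition mapped_to_one_parameter_elementary_family (r sigma : R) (i : symmetry)
    (Phi : R -> R -> R -> R) : Prop :=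
  mapped_to_elementary_solutions r sigma i Phi /\ ~ mapped_to_itself r sigma i Phi.

(* The coefficient of the function of index [n] in a sum of K terms with
   coefficients [a k] and (possibly repeated) indices [nu k], once like terms
   are collected.  If it is 0 the function does not really occur in the sum;
   with all coefficients 0, for instance, the solution c = 0 is mapped to
   itself by every symmetry. *)
Definition net_coef (K : nat) (a : nat -> R) (nu : nat -> Z) (n : Z) : R :=
  sum_n_m (fun k => if Z.eq_dec (nu k) n then a k else 0) 1 K.

(* Main.v *)
Require Import Defs.
From Stdlib Require Import Lra Lia List FunctionalExtensionality.

(** Each of the functions [C1], ..., [C4] has the separated form
    [exp (l r t) * H s] with an integer rate [l]: the rate is [n] for [C1],
    [n + 1] for [C2], [3 - n] for [C3] and [2 - n] for [C4].  As [n] runs through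
    0, -2, -4, ..., these rates run through the even integers [<= 0], the odd
    integers [<= 1], the odd integers [>= 3] and the even integers [>= 2], so each
    integer is the rate of exactly one function.  Its profile at time 0 is called
    [mode r sigma l], and the sum of the theorem is a finite combination of modes.

    Why transforms are solutions.  The Bachelier equation for
    [exp (l r t) * H s] is the ordinary equation [profile_ode] for [H].  With
    [H = y] or [H = exp (- r s^2 / sigma^2) * y], this is a Hermite equation for
    [y], and its polynomial solutions are the terminating Kummer functions of
    [s^2] ([mode_ode]).  Every [G_i] moves the time, acts on [s] by an affine map
    and multiplies [c] by a factor, so the transform of a mode has the form
    [exp (l r T) * H (q s + b) / M].  Such a function solves the equation as soon as
    [T' = q^2] and two identities free of [l] and [H] hold ([gauge_pullback]);
    checking these for the six groups gives [transformed_mode_solution], and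
    the rest is linearity.

    Why the solution is not fixed.  Conjugating [G_i] by a time translation only
    rescales its parameter ([time_shift_conjugation]).  Hence, if the sum is fixed
    by [G_i], choosing the parameter as a suitable multiple of [exp (k r t)] turns
    the invariance into a relation between exponentials in [t] with constant
    coefficients.  Exponentials with different rates are independent
    ([exp_sum_separation]), so every mode that really occurs in the sum is itself
    fixed by [G_i] ([fixed_sum_fixed_modes]).  Differentiating that invariance at
    parameter 0 gives [xi_i (c - f) = 0] on the surface [c = f]
    ([fixed_sum_generator_zero]), against the hypothesis on [f]. *)

(** * Terminating Kummer functions *)

Definition kummer_coef (e q : R) (k : nat) : R :=
  poch e k / poch q k / INR (fact k).

Lemma poch_pos q k : 0 < q -> 0 < poch q k.
Proof.
  intros hq; induction k as [|k IH]; simpl; [lra|].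
  apply Rmult_lt_0_compat; [exact IH|]. pose proof (pos_INR k); lra.
Qed.

Lemma poch_terminates j k : (j < k)%nat -> poch (- INR j) k = 0.
Proof.
  induction k as [|k IH]; intros h; [lia|]. simpl.
  destruct (Nat.eq_dec j k) as [->|]; [ring|]. rewrite IH by lia; ring.
Qed.

Lemma kummer_PSeries e q u : kummer e q u = PSeries (kummer_coef e q) u.
Proof.
  apply Series_ext; intros k; unfold kummer_coef, Rdiv. ring.
Qed.

Lemma kummer_coef_terminates j q k : (j < k)%nat -> kummer_coef (- INR j) q k = 0.
Proof.
  intros h; unfold kummer_coef. rewrite poch_terminates by exact h.
  unfold Rdiv; ring.
Qed.

Lemma kummer_coef_succ e q k : 0 < q ->
  (INR k + 1) * (INR k + q) * kummer_coef e q (S k) = (INR k + e) * kummer_coef e q k.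
Proof.
  intros hq; unfold kummer_coef.
  change (fact (S k)) with (S k * fact k)%nat. rewrite mult_INR, S_INR. simpl poch.
  pose proof (pos_INR k). pose proof (poch_pos q k hq). pose proof (INR_fact_neq_0 k).
  field; repeat split; lra.
Qed.

(** The partial sums are constant from index [j] on. *)
Lemma is_pseries_finite a j u : (forall k, (j < k)%nat -> a k = 0) ->
  is_pseries a u (sum_n (fun k => a k * u ^ k) j).
Proof.
  intros ha. apply is_pseries_R.
  eapply filterlim_ext_loc; [|apply filterlim_const].
  exists j; intros n hn; simpl. induction hn as [|n hn IH]; [reflexivity|].
  rewrite sum_Sn, <- IH. rewrite (ha (S n)) by lia.
  rewrite Rmult_0_l. symmetry; apply (plus_zero_r (G := R_AbelianMonoid)).
Qed.

(** At a point outside the disk of convergence the terms could not tend to 0;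
    here they are eventually 0, so there is no such point. *)
Lemma CV_radius_finite a j : (forall k, (j < k)%nat -> a k = 0) -> CV_radius a = p_infty.
Proof.
  intros ha.
  assert (h : forall x : R, 0 <= x -> Rbar_le x (CV_radius a)).
  { intros x hx.
    replace x with (Rabs x) by (apply Rabs_pos_eq; exact hx).
    destruct (Rbar_le_lt_dec (Rabs x) (CV_radius a)) as [hle|hlt]; [exact hle|].
    exfalso. apply (CV_disk_outside a x hlt).
    apply is_lim_seq_ext_loc with (fun _ => 0); [|apply is_lim_seq_const].
    exists (S j). intros n hn. rewrite (ha n) by lia. ring. }
  destruct (CV_radius a) as [x| |].
  - exfalso. specialize (h (Rabs x + 1)). simpl in h.
    pose proof (Rle_abs x). pose proof (Rabs_pos x). lra.
  - reflexivity.
  - exfalso. exact (h 0 (Rle_refl 0)).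
Qed.

(** Kummer's equation [u K'' + (q - u) K' - e K = 0] for [e = - j].  Comparing the
    coefficients of [u^k] gives exactly the recurrence [kummer_coef_succ]. *)
Lemma kummer_ode j q : 0 < q ->
  exists K1 K2 : R -> R, forall u,
    is_derive (kummer (- INR j) q) u (K1 u) /\ is_derive K1 u (K2 u)
    /\ u * K2 u + (q - u) * K1 u + INR j * kummer (- INR j) q u = 0.
Proof.
  intros hq.
  set (a := kummer_coef (- INR j) q).
  assert (ha : forall k, (j < k)%nat -> a k = 0)
    by (intros; apply kummer_coef_terminates; assumption).
  assert (ha1 : forall k, (j < k)%nat -> PS_derive a k = 0).
  { intros k hk; unfold PS_derive. rewrite ha by lia; ring. }
  assert (ha2 : forall k, (j < k)%nat -> PS_derive (PS_derive a) k = 0).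
  { intros k hk; unfold PS_derive at 1. rewrite ha1 by lia; ring. }
  assert (ex : forall b u, (forall k, (j < k)%nat -> b k = 0) -> ex_pseries b u).
  { intros b u hb; eexists; apply is_pseries_finite with (1 := hb). }
  exists (PSeries (PS_derive a)), (PSeries (PS_derive (PS_derive a))).
  intros u; split; [|split].
  - apply is_derive_ext with (PSeries a); [intros; symmetry; apply kummer_PSeries|].
    apply is_derive_PSeries. rewrite (CV_radius_finite a j ha); exact I.
  - apply is_derive_PSeries. rewrite (CV_radius_finite _ j ha1); exact I.
  - rewrite kummer_PSeries. fold a.
    transitivity (PSeries (PS_plus (PS_plus (PS_incr_1 (PS_derive (PS_derive a)))
       (PS_scal q (PS_derive a))) (PS_plus (PS_scal (-1) (PS_incr_1 (PS_derive a)))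
       (PS_scal (INR j) a))) u).
    + rewrite !PSeries_plus, !PSeries_scal, !PSeries_incr_1; [ring|..];
      repeat first [apply ex_pseries_plus | apply ex_pseries_scal; [apply Rmult_comm|]
                   | apply ex_pseries_incr_1 | (apply ex; assumption)].
    + transitivity (PSeries (fun _ => 0) u); [|apply PSeries_const_0]. apply PSeries_ext. intros k.
      unfold PS_plus, PS_scal, PS_derive, PS_incr_1.
      change plus with Rplus; change scal with Rmult; change mult with Rmult.
      destruct k as [|k].
      * pose proof (kummer_coef_succ (- INR j) q 0 hq) as h. fold a in h.
        simpl in *. change zero with 0. lra.
      * pose proof (kummer_coef_succ (- INR j) q (S k) hq) as h. fold a in h.
        rewrite !S_INR in *. lra.
Qed.

(** * The modes and their differential equation *)

(** The parity of [l] and its position relative to 0 and 1 tell which of the four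
    families has a member of rate [l], and which index that member has. *)
Definition mode (r sigma : R) (l : Z) : R -> R :=
  if Z.even l then
    if Z.leb l 0 then C1 r sigma l 0 else C4 r sigma (2 - l) 0
  else
    if Z.leb l 1 then C2 r sigma (l - 1) 0 else C3 r sigma (3 - l) 0.

Lemma nonpos_even_char n : nonpos_even n <-> Z.even n = true /\ (n <= 0)%Z.
Proof.
  split.
  - intros [j ->]. split; [|lia]. apply Z.even_spec. exists (- Z.of_nat j)%Z; lia.
  - intros [h hn]. apply Z.even_spec in h. destruct h as [p ->].
    exists (Z.to_nat (- p)). lia.
Qed.

Lemma C1_mode r sigma n t s : nonpos_even n ->
  C1 r sigma n t s = exp (IZR n * r * t) * mode r sigma n s.
Proof.
  intros h; apply nonpos_even_char in h as [he hn]; unfold mode.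
  rewrite he, (proj2 (Z.leb_le _ _) hn). unfold C1.
  rewrite Rmult_0_r, exp_0. ring.
Qed.

Lemma C2_mode r sigma n t s : nonpos_even n ->
  C2 r sigma n t s = exp (IZR (n + 1) * r * t) * mode r sigma (n + 1) s.
Proof.
  intros h; apply nonpos_even_char in h as [he hn]; unfold mode.
  rewrite Z.even_add, he. change (Bool.eqb true (Z.even 1)) with false. cbv iota.
  rewrite (proj2 (Z.leb_le _ _)) by lia.
  rewrite Z.add_simpl_r, plus_IZR. unfold C2.
  rewrite Rmult_0_r, exp_0. ring.
Qed.

Lemma C3_mode r sigma n t s : nonpos_even n ->
  C3 r sigma n t s = exp (IZR (3 - n) * r * t) * mode r sigma (3 - n) s.
Proof.
  intros h; apply nonpos_even_char in h as [he hn]; unfold mode.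
  rewrite Z.even_sub, he. change (Bool.eqb (Z.even 3) true) with false. cbv iota.
  rewrite (proj2 (Z.leb_gt _ _)) by lia.
  replace (3 - (3 - n))%Z with n by lia. rewrite minus_IZR. unfold C3.
  rewrite Rmult_0_r, exp_0. replace (- (IZR n - 3)) with (3 - IZR n) by ring. ring.
Qed.

Lemma C4_mode r sigma n t s : nonpos_even n ->
  C4 r sigma n t s = exp (IZR (2 - n) * r * t) * mode r sigma (2 - n) s.
Proof.
  intros h; apply nonpos_even_char in h as [he hn]; unfold mode.
  rewrite Z.even_sub, he. change (Bool.eqb (Z.even 2) true) with true. cbv iota.
  rewrite (proj2 (Z.leb_gt _ _)) by lia.
  replace (2 - (2 - n))%Z with n by lia. rewrite minus_IZR. unfold C4.
  rewrite Rmult_0_r, exp_0. replace (- (IZR n - 2)) with (2 - IZR n) by ring. ring.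
Qed.

Lemma mode_cases (P : Z -> (R -> R) -> Prop) r sigma :
  (forall n, nonpos_even n -> P n (C1 r sigma n 0)) ->
  (forall n, nonpos_even n -> P (n + 1)%Z (C2 r sigma n 0)) ->
  (forall n, nonpos_even n -> P (3 - n)%Z (C3 r sigma n 0)) ->
  (forall n, nonpos_even n -> P (2 - n)%Z (C4 r sigma n 0)) ->
  forall l, P l (mode r sigma l).
Proof.
  intros h1 h2 h3 h4 l; unfold mode.
  destruct (Z.even l) eqn:he.
  - destruct (Z.leb_spec l 0).
    + apply h1, nonpos_even_char; auto.
    + replace l with (2 - (2 - l))%Z at 1 by lia. apply h4, nonpos_even_char.
      rewrite Z.even_sub, he; split; [reflexivity|].
      apply Z.even_spec in he as [p hp]. lia.
  - assert (ho : Z.Odd l) by (apply Z.odd_spec; rewrite <- Z.negb_even, he; reflexivity).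
    destruct (Z.leb_spec l 1).
    + replace l with ((l - 1) + 1)%Z at 1 by lia. apply h2, nonpos_even_char.
      rewrite Z.even_sub, he; split; [reflexivity|lia].
    + replace l with (3 - (3 - l))%Z at 1 by lia. apply h3, nonpos_even_char.
      rewrite Z.even_sub, he; split; [reflexivity|]. destruct ho as [p hp]. lia.
Qed.

(** The Hermite equation [y'' - 2 b s y' + 2 b N y = 0], solved for [y'']. *)
Definition hermite_ode (b N : R) (y : R -> R) : Prop :=
  exists y1 : R -> R, forall s,
    is_derive y s (y1 s) /\ is_derive y1 s (2 * b * (s * y1 s - N * y s)).

(** [K1] and [K2] stand for the first two derivatives of the Kummer function, taken
    at [b s^2]. *)
Lemma kummer_of_square b j q : 0 < q ->
  exists K1 K2 : R -> R, forall s,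
    is_derive (fun s => kummer (- INR j) q (b * s ^ 2)) s (2 * b * s * K1 s)
    /\ is_derive K1 s (2 * b * s * K2 s)
    /\ b * s ^ 2 * K2 s + (q - b * s ^ 2) * K1 s
       + INR j * kummer (- INR j) q (b * s ^ 2) = 0.
Proof.
  intros hq. destruct (kummer_ode j q hq) as (K1 & K2 & hK).
  assert (hu : forall s, is_derive (fun s => b * s ^ 2) s (2 * b * s))
    by (intros; auto_derive; [exact I|ring]).
  exists (fun s => K1 (b * s ^ 2)), (fun s => K2 (b * s ^ 2)). intros s.
  destruct (hK (b * s ^ 2)) as (d1 & d2 & e).
  split; [|split; [|exact e]].
  - exact (is_derive_comp _ _ _ _ _ d1 (hu s)).
  - exact (is_derive_comp _ _ _ _ _ d2 (hu s)).
Qed.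

(** The even Hermite polynomials: Kummer's equation multiplied by [4 b]. *)
Lemma kummer_half_hermite b j :
  hermite_ode b (2 * INR j) (fun s => kummer (- INR j) (1 / 2) (b * s ^ 2)).
Proof.
  destruct (kummer_of_square b j (1 / 2)) as (K1 & K2 & hK); [lra|].
  exists (fun s => 2 * b * s * K1 s). intros s.
  destruct (hK s) as (d1 & d2 & e). split; [exact d1|].
  assert (D2 := is_derive_unique _ _ _ d2).
  auto_derive; [eexists; exact d2|].
  change (Derive (fun x => K1 x)) with (Derive K1). rewrite D2.
  apply (Rmult_eq_compat_l (4 * b)) in e. nra.
Qed.

(** The odd Hermite polynomials: Kummer's equation multiplied by [4 b s]. *)
Lemma kummer_three_halves_hermite b j :
  hermite_ode b (2 * INR j + 1) (fun s => s * kummer (- INR j) (3 / 2) (b * s ^ 2)).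
Proof.
  destruct (kummer_of_square b j (3 / 2)) as (K1 & K2 & hK); [lra|].
  set (k := fun s => kummer (- INR j) (3 / 2) (b * s ^ 2)).
  exists (fun s => k s + s * (2 * b * s * K1 s)). intros s.
  destruct (hK s) as (d1 & d2 & e).
  assert (D1 := is_derive_unique _ _ _ d1). assert (D2 := is_derive_unique _ _ _ d2).
  fold k in d1, D1.
  change (kummer (- INR j) (3 / 2) (b * s ^ 2)) with (k s) in *.
  change (Derive (fun x => k x) s = 2 * b * s * K1 s) in D1.
  change (Derive (fun x => K1 x) s = 2 * b * s * K2 s) in D2.
  split.
  - change (is_derive (fun s => s * k s) s (k s + s * (2 * b * s * K1 s))).
    auto_derive; [eexists; exact d1|]. rewrite D1. ring.
  - auto_derive; [split; [|split]; auto; eexists; eassumption|].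
    rewrite D1, D2. apply (Rmult_eq_compat_l (4 * b * s)) in e. nra.
Qed.

Lemma is_derive_gaussian b s :
  is_derive (fun s => exp (- b * s ^ 2)) s (- (2 * b * s) * exp (- b * s ^ 2)).
Proof. auto_derive; [exact I|]. simpl. ring. Qed.

(** The equation [r s H' + sigma^2 H'' / 2 + (l - 1) r H = 0], solved for [H''].  It
    says that [exp (l r t) * H s] solves the Bachelier equation. *)
Definition profile_ode (r sigma l : R) (H : R -> R) : Prop :=
  exists H1 : R -> R, forall s,
    is_derive H s (H1 s)
    /\ is_derive H1 s (- (2 * r / sigma ^ 2) * (s * H1 s + (l - 1) * H s)).

Lemma profile_ode_ext r sigma l H H' : (forall s, H s = H' s) ->
  profile_ode r sigma l H -> profile_ode r sigma l H'.
Proof.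
  intros e [H1 h]. exists H1; intros s. rewrite <- e.
  destruct (h s) as [d1 d2]. split; [|exact d2]. exact (is_derive_ext _ _ _ _ e d1).
Qed.

(** With [b = - r / sigma^2] the two equations agree, [l - 1] being [- N]. *)
Lemma hermite_profile r sigma N y :
  hermite_ode (- r / sigma ^ 2) N y -> profile_ode r sigma (1 - N) y.
Proof.
  intros [y1 h]. exists y1; intros s. destruct (h s) as [d1 d2]. split; [exact d1|].
  replace (- (2 * r / sigma ^ 2) * (s * y1 s + (1 - N - 1) * y s))
    with (2 * (- r / sigma ^ 2) * (s * y1 s - N * y s)) by (unfold Rdiv; ring).
  exact d2.
Qed.

(** Multiplying by the Gaussian reverses the sign of [r] in the Hermite equation,
    at the price of an additional zeroth-order term that shifts the rate. *)
Lemma gaussian_hermite_profile r sigma N y :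
  hermite_ode (r / sigma ^ 2) N y ->
  profile_ode r sigma (N + 2) (fun s => exp (- (r / sigma ^ 2) * s ^ 2) * y s).
Proof.
  intros [y1 h]. set (b := r / sigma ^ 2) in *.
  set (E := fun s => exp (- b * s ^ 2)).
  exists (fun s => E s * (y1 s - 2 * b * s * y s)). intros s.
  destruct (h s) as [d1 d2]. assert (dE := is_derive_gaussian b s). fold E in dE.
  change (exp (- b * s ^ 2)) with (E s) in *.
  assert (D1 := is_derive_unique _ _ _ d1). assert (D2 := is_derive_unique _ _ _ d2).
  assert (DE := is_derive_unique _ _ _ dE).
  change (Derive (fun x => y x) s = y1 s) in D1.
  change (Derive (fun x => y1 x) s = 2 * b * (s * y1 s - N * y s)) in D2.
  change (Derive (fun x => E x) s = - (2 * b * s) * E s) in DE.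
  replace (2 * r / sigma ^ 2) with (2 * b) by (unfold b, Rdiv; ring).
  split.
  - change (is_derive (fun s => E s * y s) s (E s * (y1 s - 2 * b * s * y s))).
    auto_derive; [repeat (split || (eexists; eassumption) || exact I)|].
    rewrite D1, DE. ring.
  - auto_derive; [repeat (split || (eexists; eassumption) || exact I)|].
    rewrite D1, D2, DE. ring.
Qed.

(** With [j] given by [n = - 2 j], the Hermite parameter [N] is [2 j] for the families
    with [q = 1 / 2] and [2 j + 1] for those with [q = 3 / 2]. *)
Lemma mode_ode r sigma l : sigma <> 0 -> profile_ode r sigma (IZR l) (mode r sigma l).
Proof.
  intros hs. apply (mode_cases (fun l H => profile_ode r sigma (IZR l) H)); clear l;
    intros n [j ->];
    unfold C1, C2, C3, C4;
    rewrite ?plus_IZR, ?minus_IZR, mult_IZR, <- INR_IZR_INZ;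
    replace (-2 * INR j / 2) with (- INR j) by field.
  - replace (-2 * INR j) with (1 - (2 * INR j + 1)) by ring.
    eapply profile_ode_ext; [|apply hermite_profile, kummer_three_halves_hermite].
    intros s. rewrite Rmult_0_r, exp_0, Rmult_1_r.
    do 2 f_equal. field; exact hs.
  - replace (-2 * INR j + 1) with (1 - (2 * INR j)) by ring.
    eapply profile_ode_ext; [|apply hermite_profile, kummer_half_hermite].
    intros s. rewrite Rmult_0_r, exp_0, Rmult_1_r.
    f_equal. field; exact hs.
  - replace (3 - -2 * INR j) with ((2 * INR j + 1) + 2) by ring.
    eapply profile_ode_ext;
      [|apply gaussian_hermite_profile, kummer_three_halves_hermite].
    intros s. rewrite Rmult_0_r, exp_0, Rmult_1_r, Rmult_assoc.
    f_equal; [f_equal|do 2 f_equal]; field; exact hs.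
  - replace (2 - -2 * INR j) with (2 * INR j + 2) by ring.
    eapply profile_ode_ext;
      [|apply gaussian_hermite_profile, kummer_half_hermite].
    intros s. rewrite Rmult_0_r, exp_0, Rmult_1_r.
    f_equal; f_equal; field; exact hs.
Qed.

(** * The symmetry groups act on separated solutions *)

Ltac derive_side :=
  repeat split; try exact I; try assumption; try (eexists; eassumption).

(** Derivatives of [A] and [M] are given in logarithmic form because both are
    products of exponentials and powers, whose logarithmic derivatives are rational. *)
Lemma is_derive_quotient (A B M : R -> R) x a b m :
  is_derive A x (a * A x) -> is_derive B x b -> is_derive M x (m * M x) -> M x <> 0 ->
  is_derive (fun x => A x * B x / M x) x (A x * (b + (a - m) * B x) / M x).
Proof.
  intros dA dB dM h.
  assert (DA := is_derive_unique _ _ _ dA). assert (DB := is_derive_unique _ _ _ dB).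
  assert (DM := is_derive_unique _ _ _ dM).
  change (Derive (fun x => A x) x = a * A x) in DA.
  change (Derive (fun x => B x) x = b) in DB.
  change (Derive (fun x => M x) x = m * M x) in DM.
  auto_derive; [derive_side|]. rewrite DA, DB, DM. field; exact h.
Qed.

(** [mt] and [ms] are the logarithmic derivatives of the factor [M] in [t] and [s],
    and [q] is the slope of [S] in [s].  After [H''] is eliminated by the profile
    equation, the left side of the Bachelier equation is a combination of [H] and
    [H'] at [S t s].  In the coefficient of [H] the rate only enters as
    [l r (T' - q^2)], so it cancels; the last two hypotheses say that what remains
    of the coefficients of [H'] and [H] vanishes. *)
Lemma gauge_pullback r sigma l H (D : R -> Prop) (T q : R -> R)
    (S M St mt ms mss : R -> R -> R) :
  sigma <> 0 -> profile_ode r sigma l H ->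
  (forall t, D t -> is_derive T t (q t ^ 2)) ->
  (forall t s, D t -> is_derive (fun t' => S t' s) t (St t s)) ->
  (forall t s, D t -> is_derive (S t) s (q t)) ->
  (forall t s, D t -> is_derive (fun t' => M t' s) t (mt t s * M t s)) ->
  (forall t s, D t -> is_derive (M t) s (ms t s * M t s)) ->
  (forall t s, D t -> is_derive (ms t) s (mss t s)) ->
  (forall t s, D t -> M t s <> 0) ->
  (forall t s, D t ->
     r * s * q t - sigma ^ 2 * ms t s * q t + St t s - q t ^ 2 * r * S t s = 0) ->
  (forall t s, D t ->
     - (r * s * ms t s) + 1 / 2 * sigma ^ 2 * (ms t s ^ 2 - mss t s) - mt t s
     - r + q t ^ 2 * r = 0) ->
  satisfies_bachelier r sigma D (fun t s => exp (l * r * T t) * H (S t s) / M t s).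
Proof.
  intros hs [H1 hH] hT hSt hSs hMt hMs hms hM c1 c2.
  set (u := fun t s => exp (l * r * T t) * H (S t s) / M t s).
  assert (ut : forall t s, D t -> is_derive (fun t' => u t' s) t
    (exp (l * r * T t) * (H1 (S t s) * St t s + (l * r * q t ^ 2 - mt t s) * H (S t s)) / M t s)).
  { intros t s ht.
    apply (is_derive_quotient (fun t => exp (l * r * T t)) (fun t => H (S t s))
             (fun t => M t s)); auto.
    - assert (dT := hT t ht). assert (DT := is_derive_unique _ _ _ dT).
      change (Derive (fun t => T t) t = q t ^ 2) in DT.
      auto_derive; [derive_side|]. rewrite DT. ring.
    - rewrite Rmult_comm. exact (is_derive_comp _ _ _ _ _ (proj1 (hH _)) (hSt t s ht)). }
  assert (us : forall t s, D t -> is_derive (u t) s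
    (exp (l * r * T t) * (H1 (S t s) * q t + (0 - ms t s) * H (S t s)) / M t s)).
  { intros t s ht.
    apply (is_derive_quotient (fun _ => exp (l * r * T t)) (fun s => H (S t s)) (M t)); auto.
    - rewrite Rmult_0_l; auto_derive; [exact I|reflexivity].
    - rewrite Rmult_comm. exact (is_derive_comp _ _ _ _ _ (proj1 (hH _)) (hSs t s ht)). }
  assert (uss : forall t s, D t -> is_derive (Derive (u t)) s
    (exp (l * r * T t) *
       (- (2 * r / sigma ^ 2) * (S t s * H1 (S t s) + (l - 1) * H (S t s)) * q t * q t
        - (mss t s * H (S t s) + ms t s * (H1 (S t s) * q t))
        + (0 - ms t s) * (H1 (S t s) * q t + (0 - ms t s) * H (S t s))) / M t s)).
  { intros t s ht.
    eapply is_derive_ext;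
      [intros s'; symmetry; apply is_derive_unique; exact (us t s' ht)|].
    apply (is_derive_quotient (fun _ => exp (l * r * T t))
             (fun s => H1 (S t s) * q t + (0 - ms t s) * H (S t s)) (M t)); auto.
    - rewrite Rmult_0_l; auto_derive; [exact I|reflexivity].
    - set (h1 := fun s => H1 (S t s)). set (h := fun s => H (S t s)). set (m := ms t).
      assert (d1 : is_derive h1 s (q t *
        (- (2 * r / sigma ^ 2) * (S t s * H1 (S t s) + (l - 1) * H (S t s)))))
        by exact (is_derive_comp _ _ _ _ _ (proj2 (hH _)) (hSs t s ht)).
      assert (d : is_derive h s (q t * H1 (S t s)))
        by exact (is_derive_comp _ _ _ _ _ (proj1 (hH _)) (hSs t s ht)).
      assert (dm : is_derive m s (mss t s)) by exact (hms t s ht).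
      change (is_derive (fun s => h1 s * q t + (0 - m s) * h s) s
        (- (2 * r / sigma ^ 2) * (S t s * h1 s + (l - 1) * h s) * q t * q t
         - (mss t s * h s + m s * (h1 s * q t)))).
      assert (D1 := is_derive_unique _ _ _ d1). assert (D0 := is_derive_unique _ _ _ d).
      assert (Dm := is_derive_unique _ _ _ dm).
      auto_derive; [derive_side|].
      change (Derive (fun x => h1 x)) with (Derive h1).
      change (Derive (fun x => h x)) with (Derive h).
      change (Derive (fun x => m x)) with (Derive m).
      rewrite D1, D0, Dm. fold (h1 s) (h s). unfold h1, h. ring. }
  intros t s ht. split; [|split; [|split]].
  - eexists; exact (ut t s ht).
  - exists (mkposreal 1 Rlt_0_1). intros s' _. eexists; exact (us t s' ht).
  - eexists; exact (uss t s ht).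
  - change (Derive_n (u t) 2 s) with (Derive (Derive (u t)) s).
    assert (Dt : Derive (fun t' : R => u t' s) t = _)
      by exact (is_derive_unique _ _ _ (ut t s ht)).
    rewrite Dt, (is_derive_unique _ _ _ (us t s ht)),
      (is_derive_unique _ _ _ (uss t s ht)).
    assert (e1 := c1 t s ht). assert (e2 := c2 t s ht). assert (hm := hM t s ht).
    unfold u.
    transitivity (exp (l * r * T t) / M t s *
      (H1 (S t s) * (r * s * q t - sigma ^ 2 * ms t s * q t + St t s - q t ^ 2 * r * S t s)
       + H (S t s) * (- (r * s * ms t s) + 1 / 2 * sigma ^ 2 * (ms t s ^ 2 - mss t s)
           - mt t s - r + q t ^ 2 * r))).
    + field; split; assumption.
    + rewrite e1, e2; ring.
Qed.

Definition G_slope (r : R) (i : symmetry) (eps t : R) : R :=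
  match i with
  | sym4 => exp (r * t) / sqrt (exp (2 * r * t) + eps)
  | sym5 => exp (- r * t) / sqrt (exp (- 2 * r * t) + eps)
  | sym1 | sym2 | sym3 | sym6 => 1
  end.

Lemma G_c_factor r sigma i eps t s c :
  G_c r sigma i eps t s c = G_c r sigma i eps t s 1 * c.
Proof. destruct i; simpl; unfold Rdiv; ring. Qed.

Lemma G_c_pos r sigma i eps t s : G_dom r i eps t -> 0 < G_c r sigma i eps t s 1.
Proof.
  destruct i; unfold G_dom, G_c; intros h; rewrite ?Rmult_1_r;
    try apply Rlt_0_1; try apply exp_pos.
  - apply Rmult_lt_0_compat; [apply exp_pos|exact h].
  - apply Rdiv_lt_0_compat; [apply exp_pos|apply sqrt_lt_R0; exact h].
Qed.

Lemma exp_sqr x y : y = 2 * x -> exp y = exp x * exp x.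
Proof. intros ->. rewrite <- exp_plus. f_equal; ring. Qed.

(** The formulas for [sym4] and [sym5] are rational in [eps], [Q = sqrt (E + eps)] and
    [y], where [E = y^2] is an exponential.  Since [eps = Q^2 - y^2], they become
    identities between rational functions of the independent unknowns [Q] and [y]. *)
Ltac sqrt_field :=
  lazymatch goal with
  | hE : ?E = ?x * ?x, h : 0 < ?E + ?eps |- _ =>
      let Q := fresh "Q" in
      let hQ := fresh "hQ" in
      let hQ2 := fresh "hQ2" in
      assert (hQ := sqrt_lt_R0 _ h); assert (hQ2 := sqrt_sqrt _ (Rlt_le _ _ h));
      set (Q := sqrt (E + eps)) in *; clearbody Q;
      let y := fresh "y" in
      let F := fresh "F" in
      set (y := x) in *; clearbody y; set (F := E) in *; clearbody F; subst F;
      let he := fresh "he" in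
      assert (he : eps = Q * Q - y * y) by lra; clear h hQ2; subst eps;
      assert (0 < Q * Q) by (apply Rmult_lt_0_compat; exact hQ)
  end; field; repeat split; lra.

(** Each group satisfies the two identities of [gauge_pullback].  The derivatives
    passed to it are those of [G_s] and of the logarithm of the factor of [c]: for
    [sym4], for instance, this logarithm is
    [- 2 r t + r eps s^2 / (sigma^2 X) + ln X] with [X = exp (2 r t) + eps]. *)
Lemma transformed_mode_solution r sigma i eps l H :
  r <> 0 -> sigma <> 0 -> profile_ode r sigma l H ->
  satisfies_bachelier r sigma (G_dom r i eps)
    (fun t s => exp (l * r * G_t r i eps t) * H (G_s r i eps t s)
                / G_c r sigma i eps t s 1).
Proof.
  intros hr hs hH.
  assert (hM : forall t s, G_dom r i eps t -> G_c r sigma i eps t s 1 <> 0)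
    by (intros t s h; apply (G_c_pos r sigma i eps t s) in h; lra).
  assert (hS : forall t s, G_dom r i eps t -> is_derive (G_s r i eps t) s (G_slope r i eps t)).
  { intros t s h. destruct i; unfold G_s, G_slope; auto_derive; auto; try ring.
    all: unfold Rdiv; ring. }
  destruct i; unfold G_dom in *.
  - apply (gauge_pullback r sigma l H _ _ (G_slope r sym1 eps) _ _ (fun _ _ => 0)
             (fun _ _ => 0) (fun _ _ => 0) (fun _ _ => 0)); auto;
      intros t; intros; unfold G_t, G_s, G_c, G_slope; try (auto_derive; [exact I|]); try ring.
  - apply (gauge_pullback r sigma l H _ _ (G_slope r sym2 eps) _ _
             (fun t _ => eps * r * exp (r * t)) (fun _ _ => 0) (fun _ _ => 0) (fun _ _ => 0)); auto;
      intros t; intros; unfold G_t, G_s, G_c, G_slope; try (auto_derive; [exact I|]); try ring.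
  - apply (gauge_pullback r sigma l H _ _ (G_slope r sym3 eps) _ _
             (fun t _ => - (eps * r * exp (- r * t)))
             (fun t s => eps * r ^ 2 * exp (- r * t) * (2 * eps * exp (- r * t) + 2 * s)
                         / sigma ^ 2)
             (fun t _ => - (2 * eps * r * exp (- r * t) / sigma ^ 2)) (fun _ _ => 0)); auto;
      intros t; intros; unfold G_t, G_s, G_c, G_slope;
      try (auto_derive; [exact I|]); try (field; exact hs);
      unfold Rdiv, Rminus; simpl; field; exact hs.
  - apply (gauge_pullback r sigma l H _ _ (G_slope r sym4 eps) _ _
             (fun t s => r * G_slope r sym4 eps t * s * (1 - exp (2 * r * t) / (exp (2 * r * t) + eps)))
             (fun t s => - 2 * r - 2 * r ^ 2 * eps * s ^ 2 * exp (2 * r * t)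
                           / (sigma ^ 2 * (exp (2 * r * t) + eps) ^ 2)
                         + 2 * r * exp (2 * r * t) / (exp (2 * r * t) + eps))
             (fun t s => 2 * r * eps * s / (sigma ^ 2 * (exp (2 * r * t) + eps)))
             (fun t _ => 2 * r * eps / (sigma ^ 2 * (exp (2 * r * t) + eps)))); auto;
      intros t; intros; unfold G_t, G_s, G_c, G_slope;
      assert (hx := exp_sqr (r * t) (2 * r * t) ltac:(ring)).
    + auto_derive; [auto|]. sqrt_field.
    + auto_derive;
        [assert (0 < sqrt (exp (2 * r * t) + eps)) by (apply sqrt_lt_R0; auto); derive_side; lra|].
      sqrt_field.
    + auto_derive; [derive_side|].
      2: { unfold Rdiv, Rminus; simpl. field. lra. }
      assert (0 < sigma ^ 2 * (exp (2 * r * t) + eps))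
        by (apply Rmult_lt_0_compat; [apply pow2_gt_0; exact hs|assumption]).
      simpl in *; lra.
    + auto_derive; [exact I|]. unfold Rdiv, Rminus; simpl. field; lra.
    + auto_derive; [exact I|]. unfold Rdiv, Rminus; simpl. field; lra.
    + sqrt_field.
    + sqrt_field.
  - apply (gauge_pullback r sigma l H _ _ (G_slope r sym5 eps) _ _
             (fun t s => r * G_slope r sym5 eps t * s * (exp (- 2 * r * t) / (exp (- 2 * r * t) + eps) - 1))
             (fun t s => r * (exp (- 2 * r * t) / (exp (- 2 * r * t) + eps) - 1))
             (fun _ _ => 0) (fun _ _ => 0)); auto;
      intros t; intros; unfold G_t, G_s, G_c, G_slope;
      assert (hx := exp_sqr (- r * t) (- 2 * r * t) ltac:(ring)).
    + auto_derive; [auto|]. sqrt_field.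
    + auto_derive;
        [assert (0 < sqrt (exp (- 2 * r * t) + eps)) by (apply sqrt_lt_R0; auto); derive_side; lra|].
      sqrt_field.
    + auto_derive;
        [assert (0 < sqrt (exp (- 2 * r * t) + eps)) by (apply sqrt_lt_R0; auto); derive_side; lra|].
      sqrt_field.
    + auto_derive; [exact I|]. ring.
    + auto_derive; [exact I|]. ring.
    + sqrt_field.
    + sqrt_field.
  - apply (gauge_pullback r sigma l H _ _ (G_slope r sym6 eps) _ _ (fun _ _ => 0)
             (fun _ _ => 0) (fun _ _ => 0) (fun _ _ => 0)); auto;
      intros t; intros; unfold G_t, G_s, G_c, G_slope; try (auto_derive; [exact I|]); try ring.
Qed.

(** * Finite sums and linearity *)

Definition lsum {A : Type} (f : A -> R) (L : list A) : R :=
  fold_right (fun x acc => f x + acc) 0 L.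

Lemma lsum_app {A : Type} (f : A -> R) L L' : lsum f (L ++ L') = lsum f L + lsum f L'.
Proof. induction L as [|x L IH]; simpl; [|rewrite IH]; ring. Qed.

Lemma lsum_linear {A : Type} (f g h : A -> R) a b L :
  (forall x, h x = a * f x + b * g x) -> lsum h L = a * lsum f L + b * lsum g L.
Proof. intros e; induction L as [|x L IH]; simpl; [|rewrite e, IH]; ring. Qed.

Lemma sum_n_m_lsum {A : Type} (g : nat -> A) (f : A -> R) (F : nat -> R) K :
  (forall k, (1 <= k <= K)%nat -> F k = f (g k)) ->
  sum_n_m F 1 K = lsum f (map g (seq 1 K)).
Proof.
  induction K as [|K IH]; intros h.
  - rewrite sum_n_m_zero by lia. reflexivity.
  - rewrite seq_S, map_app, lsum_app, sum_n_Sm by lia. simpl.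
    rewrite <- IH by (intros; apply h; lia). rewrite h by lia.
    change plus with Rplus. ring.
Qed.

Lemma sum_n_lsum (f : nat -> R) j : sum_n f j = lsum f (seq 0 (S j)).
Proof.
  induction j as [|j IH].
  - rewrite sum_O. simpl. ring.
  - rewrite sum_Sn, seq_S, lsum_app, IH. simpl. change plus with Rplus. ring.
Qed.

Lemma satisfies_plus r sigma D u v :
  satisfies_bachelier r sigma D u -> satisfies_bachelier r sigma D v ->
  satisfies_bachelier r sigma D (fun t s => u t s + v t s).
Proof.
  intros hu hv t s ht.
  destruct (hu t s ht) as (ut & us & uss & eu), (hv t s ht) as (vt & vs & vss & ev).
  assert (hs : locally s (fun s' => ex_derive (fun s => u t s + v t s) s'
             /\ Derive (fun s => u t s + v t s) s' = Derive (u t) s' + Derive (v t) s')).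
  { generalize (filter_and _ _ us vs). apply filter_imp. intros s' [hu' hv']. split.
    - apply (ex_derive_plus (u t) (v t)); assumption.
    - apply (Derive_plus (u t) (v t)); assumption. }
  assert (hs' : locally s (fun s' => Derive (u t) s' + Derive (v t) s'
                  = Derive (fun s => u t s + v t s) s')).
  { revert hs; apply filter_imp; intros s' [_ e]; symmetry; exact e. }
  split; [|split; [|split]].
  - apply (ex_derive_plus (fun t => u t s) (fun t => v t s)); assumption.
  - revert hs; apply filter_imp; tauto.
  - apply (ex_derive_ext_loc _ _ _ hs').
    apply (ex_derive_plus (Derive (u t)) (Derive (v t))); assumption.
  - change (Derive_n (fun s => u t s + v t s) 2 s)
      with (Derive (Derive (fun s => u t s + v t s)) s).
    change (Derive_n (u t) 2 s) with (Derive (Derive (u t)) s) in eu.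
    change (Derive_n (v t) 2 s) with (Derive (Derive (v t)) s) in ev.
    rewrite <- (Derive_ext_loc _ _ _ hs').
    rewrite (Derive_plus (Derive (u t)) (Derive (v t))) by assumption.
    rewrite (Derive_plus (fun t : R => u t s) (fun t : R => v t s)) by assumption.
    rewrite (proj2 (locally_singleton _ _ hs)).
    lra.
Qed.

Lemma satisfies_scal r sigma D a u :
  satisfies_bachelier r sigma D u ->
  satisfies_bachelier r sigma D (fun t s => a * u t s).
Proof.
  intros hu t s ht.
  destruct (hu t s ht) as (ut & us & uss & eu).
  assert (e : forall s', Derive (fun s => a * u t s) s' = a * Derive (u t) s')
    by (intros; apply Derive_scal).
  split; [|split; [|split]].
  - apply (ex_derive_scal (fun t => u t s)); assumption.
  - revert us; apply filter_imp. intros s'. apply (ex_derive_scal (u t)).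
  - apply (ex_derive_ext (fun s => a * Derive (u t) s)); [intros; symmetry; apply e|].
    apply (ex_derive_scal (Derive (u t))); assumption.
  - change (Derive_n (fun s => a * u t s) 2 s) with (Derive (Derive (fun s => a * u t s)) s).
    change (Derive_n (u t) 2 s) with (Derive (Derive (u t)) s) in eu.
    assert (es := e s).
    assert (ess : Derive (Derive (fun s => a * u t s)) s = a * Derive (Derive (u t)) s)
      by (rewrite (Derive_ext _ _ _ e); apply Derive_scal).
    assert (et : Derive (fun t' : R => a * u t' s) t = a * Derive (fun t' : R => u t' s) t)
      by apply Derive_scal.
    rewrite es, ess, et.
    replace 0 with (a * 0) by ring. rewrite <- eu. ring.
Qed.

Lemma satisfies_zero r sigma D : satisfies_bachelier r sigma D (fun _ _ => 0).
Proof.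
  assert (e : forall s, Derive (fun _ : R => 0) s = 0) by (intros; apply Derive_const).
  intros t s _. split; [|split; [|split]].
  - apply ex_derive_const.
  - apply filter_forall; intros; apply ex_derive_const.
  - apply (ex_derive_ext (fun _ => 0)); [intros; symmetry; apply e|]. apply ex_derive_const.
  - change (Derive_n (fun _ => 0) 2 s) with (Derive (Derive (fun _ => 0)) s).
    assert (es := e s).
    assert (ess : Derive (Derive (fun _ => 0)) s = 0)
      by (rewrite (Derive_ext _ _ _ e); apply e).
    assert (et := e t). rewrite es, ess, et. ring.
Qed.

Lemma satisfies_lsum {A : Type} r sigma D (c : A -> R) (u : A -> R -> R -> R) L :
  (forall x, satisfies_bachelier r sigma D (u x)) ->
  satisfies_bachelier r sigma D (fun t s => lsum (fun x => c x * u x t s) L).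
Proof.
  intros h; induction L as [|x L IH]; simpl.
  - apply satisfies_zero.
  - apply satisfies_plus; [apply satisfies_scal, h|exact IH].
Qed.

(** * Elementary functions *)

Lemma elementary_lsum {A : Type} D (u : A -> R -> R -> R) L :
  (forall x, elementary D (u x)) -> elementary D (fun t s => lsum (fun x => u x t s) L).
Proof.
  intros h; induction L as [|x L IH]; simpl.
  - apply el_const.
  - apply el_plus; [apply h|exact IH].
Qed.

Lemma elementary_pow D f k : elementary D f -> elementary D (fun t s => f t s ^ k).
Proof.
  intros h; induction k as [|k IH]; simpl; [apply el_const|apply el_mult; assumption].
Qed.

Lemma elementary_minus D f g : elementary D f -> elementary D g ->
  elementary D (fun t s => f t s - g t s).
Proof. intros hf hg. apply el_plus; [|apply el_opp]; assumption. Qed.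

Lemma elementary_div D f g : elementary D f -> elementary D g ->
  (forall t s, D t -> g t s <> 0) -> elementary D (fun t s => f t s / g t s).
Proof. intros hf hg h. apply el_mult; [|apply el_inv]; assumption. Qed.

(** The terminating Kummer function is a polynomial, so no series is left. *)
Lemma elementary_kummer D j q f : elementary D f ->
  elementary D (fun t s => kummer (- INR j) q (f t s)).
Proof.
  intros hf.
  apply el_ext with (fun t s =>
    lsum (fun k => kummer_coef (- INR j) q k * f t s ^ k) (seq 0 (S j))).
  - apply (elementary_lsum _ (fun k t s => kummer_coef (- INR j) q k * f t s ^ k)).
    intros k. apply el_mult; [apply el_const|apply elementary_pow; exact hf].
  - intros t s _. rewrite kummer_PSeries. symmetry. apply is_pseries_unique.
    rewrite <- sum_n_lsum.
    apply is_pseries_finite. intros; apply kummer_coef_terminates; assumption.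
Qed.

Lemma elementary_mode r sigma l D f : sigma <> 0 -> elementary D f ->
  elementary D (fun t s => mode r sigma l (f t s)).
Proof.
  intros hs hf.
  apply (mode_cases (fun _ H => elementary D (fun t s => H (f t s)))); clear l;
    intros n [j ->]; unfold C1, C2, C3, C4; rewrite mult_IZR, <- INR_IZR_INZ;
    replace (-2 * INR j / 2) with (- INR j) by field;
    repeat first [exact hf | apply elementary_kummer | apply el_mult | apply el_exp
                 | apply elementary_pow | apply el_const | apply elementary_div; [| |auto]].
Qed.

Ltac elementary_step :=
  first [apply el_const | apply el_t | apply el_s | apply el_exp
        | apply elementary_pow | apply elementary_minus | apply el_opp
        | apply elementary_div | apply el_plus | apply el_mult | apply el_ln | apply el_sqrt].

Lemma elementary_G r sigma i eps : r <> 0 -> sigma <> 0 ->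
  elementary (G_dom r i eps) (fun t _ => G_t r i eps t)
  /\ elementary (G_dom r i eps) (fun t s => G_s r i eps t s)
  /\ elementary (G_dom r i eps) (fun t s => G_c r sigma i eps t s 1).
Proof.
  intros hr hs.
  assert (hq : forall x, 0 < x -> sqrt x <> 0) by (intros x hx; apply sqrt_lt_R0 in hx; lra).
  destruct i; unfold G_t, G_s, G_c, G_dom; split; [|split| |split| |split| |split| |split| |split];
    repeat elementary_step; intros t s h; auto; try lra; try (apply pow_nonzero; assumption).
  apply Rmult_integral_contrapositive_currified; [apply pow_nonzero; assumption|lra].
Qed.

(** * Sums of modes *)

Definition mode_sum (r sigma : R) (L : list (R * Z)) (t s : R) : R :=
  lsum (fun p => fst p * (exp (IZR (snd p) * r * t) * mode r sigma (snd p) s)) L.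

(** The analogue of [net_coef] for a list of pairs (coefficient, rate). *)
Definition collected (L : list (R * Z)) (nu : Z) : R :=
  lsum (fun p => if Z.eq_dec (snd p) nu then fst p else 0) L.

(** The transform of [c - u] vanishes exactly where [c] is [u (G_t, G_s)] divided by
    the positive factor of [G_c], which is again a sum of transformed modes. *)
Lemma mode_sum_mapped r sigma i L : r <> 0 -> sigma <> 0 ->
  mapped_to_elementary_solutions r sigma i (fun t s c => c - mode_sum r sigma L t s).
Proof.
  intros hr hs eps.
  exists (fun t s => lsum (fun p => fst p *
    (exp (IZR (snd p) * r * G_t r i eps t) * mode r sigma (snd p) (G_s r i eps t s)
     / G_c r sigma i eps t s 1)) L).
  split; [|split].
  - intros t s c ht. unfold transform. rewrite G_c_factor.
    assert (hM := G_c_pos r sigma i eps t s ht).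
    set (M := G_c r sigma i eps t s 1) in *.
    replace (lsum _ L) with (mode_sum r sigma L (G_t r i eps t) (G_s r i eps t s) / M).
    + split; intros h.
      * apply (Rmult_eq_reg_l M); [|lra]. rewrite (Rmult_comm M (_ / _)).
        unfold Rdiv. rewrite Rmult_assoc, Rinv_l by lra. lra.
      * rewrite h. field. lra.
    + unfold mode_sum. symmetry. rewrite <- (Rplus_0_r (_ / M)).
      etransitivity; [apply (lsum_linear (fun p => fst p * (exp (IZR (snd p) * r * G_t r i eps t)
        * mode r sigma (snd p) (G_s r i eps t s))) (fun _ => 0) _ (/ M) 0);
        intros; unfold Rdiv; ring|unfold Rdiv; ring].
  - apply (satisfies_lsum r sigma _ fst (fun p t s =>
      exp (IZR (snd p) * r * G_t r i eps t) * mode r sigma (snd p) (G_s r i eps t s)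
      / G_c r sigma i eps t s 1)).
    intros p. apply transformed_mode_solution; auto. apply mode_ode; exact hs.
  - destruct (elementary_G r sigma i eps hr hs) as (et & es & ec).
    apply (elementary_lsum _ (fun p t s => fst p *
      (exp (IZR (snd p) * r * G_t r i eps t) * mode r sigma (snd p) (G_s r i eps t s)
      / G_c r sigma i eps t s 1))).
    intros p. apply el_mult; [apply el_const|]. apply elementary_div; [|exact ec|].
    + apply el_mult; [|apply elementary_mode; assumption].
      apply el_exp. apply el_mult; [apply el_const|exact et].
    + intros t s h. apply (G_c_pos r sigma i eps t s) in h; lra.
Qed.

(** * Independence of the modes *)

Lemma exp_IZR_inj p q : exp (IZR p) = exp (IZR q) -> p = q.
Proof. intros h; apply eq_IZR, exp_inv, h. Qed.

(** The difference operator [g (t + 1 / r) - exp (rate x0) * g t] removes the head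
    [x0] of the list when its rate is not [nu]; it multiplies every other
    coefficient by [exp (rate x) - exp (rate x0)], which is not 0 at the rate [nu].
    When the rate of the head is [nu], its coefficient is moved into the
    accumulator [b]. *)
Lemma exp_sum_separation {A : Type} (rate : A -> Z) r nu L : r <> 0 ->
  forall (c : A -> R) b,
  (forall t, lsum (fun x => c x * exp (IZR (rate x) * r * t)) L
             + b * exp (IZR nu * r * t) = 0) ->
  lsum (fun x => if Z.eq_dec (rate x) nu then c x else 0) L + b = 0.
Proof.
  intros hr. induction L as [|x0 L IH]; intros c b h; simpl in *.
  - specialize (h 0). rewrite Rmult_0_r, exp_0 in h. lra.
  - destruct (Z.eq_dec (rate x0) nu) as [e|e].
    + rewrite Rplus_assoc, (Rplus_comm (c x0)), Rplus_assoc, (Rplus_comm b). apply IH.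
      intros t. rewrite <- (h t), e. ring.
    + set (k := exp (IZR (rate x0))).
      assert (hk : exp (IZR nu) - k <> 0).
      { intros h0. apply e, exp_IZR_inj. unfold k in h0. lra. }
      assert (shift : forall l t, exp (IZR l * r * (t + / r)) = exp (IZR l) * exp (IZR l * r * t)).
      { intros l t. rewrite <- exp_plus. f_equal. field. exact hr. }
      assert (h' := IH (fun x => c x * (exp (IZR (rate x)) - k)) (b * (exp (IZR nu) - k))).
      rewrite (lsum_linear (fun x => if Z.eq_dec (rate x) nu then c x else 0) (fun _ => 0)
                 (fun x => if Z.eq_dec (rate x) nu then c x * (exp (IZR (rate x)) - k) else 0)
                 (exp (IZR nu) - k) 0) in h'.
      2: { intros x. destruct (Z.eq_dec (rate x) nu) as [->|]; ring. }
      rewrite Rplus_0_l.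
      apply (Rmult_eq_reg_l (exp (IZR nu) - k)); [|exact hk].
      rewrite Rmult_0_r, Rmult_plus_distr_l. etransitivity; [|apply h']; [ring|].
      intros t.
      rewrite (lsum_linear (fun x => c x * exp (IZR (rate x) * r * (t + / r)))
                 (fun x => c x * exp (IZR (rate x) * r * t)) _ 1 (- k)).
      2: { intros x. rewrite shift. ring. }
      (* the relation at [t + 1 / r] minus [k] times the relation at [t] *)
      assert (h1 := h (t + / r)). assert (h0 := h t).
      rewrite !shift in h1. fold k in h1.
      assert (h2 := f_equal2 (fun u v => u - k * v) h1 h0). cbv beta in h2.
      rewrite Rmult_0_r, Rminus_0_r in h2. etransitivity; [|exact h2]. ring.
Qed.

(** * Invariant sums have invariant modes *)

(** Translating the time by [t] conjugates the transformation of parameter [del]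
    into the one of parameter [del * time_weight r i t]. *)
Definition time_weight (r : R) (i : symmetry) (t : R) : R :=
  match i with
  | sym1 | sym6 => 1
  | sym2 => exp (- r * t)
  | sym3 => exp (r * t)
  | sym4 => exp (2 * r * t)
  | sym5 => exp (- 2 * r * t)
  end.

Lemma time_weight_pos r i t : 0 < time_weight r i t.
Proof. destruct i; simpl; try apply exp_pos; apply Rlt_0_1. Qed.

Lemma sqrt_exp_double x y : y = 2 * x -> sqrt (exp y) = exp x.
Proof.
  intros h. rewrite (exp_sqr x y h). apply sqrt_square. left; apply exp_pos.
Qed.

(** With the parameter rescaled according to the time, the action on [s] and [c] is
    the one at time 0 and the time is shifted by a constant. *)
Lemma time_shift_conjugation r sigma i del t s c : r <> 0 -> sigma <> 0 ->
  G_dom r i del 0 ->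
  let eps := del * time_weight r i t in
  G_dom r i eps t
  /\ G_t r i eps t = t + G_t r i del 0
  /\ G_s r i eps t s = G_s r i del 0 s
  /\ G_c r sigma i eps t s c = G_c r sigma i del 0 s c.
Proof.
  intros hr hs hd eps; subst eps.
  destruct i; unfold G_dom, G_t, G_s, G_c, time_weight in *;
    rewrite ?Rmult_0_r, ?exp_0 in *.
  - repeat split; ring.
  - repeat split; try ring. rewrite Rmult_assoc, <- exp_plus.
    replace (- r * t + r * t) with 0 by ring. rewrite exp_0; ring.
  - assert (e : del * exp (r * t) * exp (- r * t) = del).
    { rewrite Rmult_assoc, <- exp_plus.
      replace (r * t + - r * t) with 0 by ring. rewrite exp_0; ring. }
    rewrite e. repeat split; try ring.
    replace (del * exp (r * t) * r * exp (- r * t)) with (del * r)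
      by (rewrite <- e at 1; ring).
    do 2 f_equal. field; exact hs.
  - assert (hE := exp_pos (2 * r * t)). assert (hx := exp_pos (r * t)).
    replace (exp (2 * r * t) + del * exp (2 * r * t))
      with (exp (2 * r * t) * (1 + del)) by ring.
    assert (hq := sqrt_lt_R0 _ hd).
    repeat split.
    + apply Rmult_lt_0_compat; assumption.
    + rewrite ln_mult, ln_exp by assumption. field; exact hr.
    + rewrite sqrt_mult, (sqrt_exp_double (r * t)) by lra. field. split; lra.
    + assert (e : exp (2 * r * t) = / exp (- (2 * r * t)))
        by (rewrite exp_Ropp, Rinv_inv; reflexivity).
      replace (- (r * (2 * sigma ^ 2 * t * (exp (2 * r * t) * (1 + del))
                       - del * exp (2 * r * t) * s ^ 2)
                  / (sigma ^ 2 * (exp (2 * r * t) * (1 + del)))))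
        with (- (2 * r * t) + - (r * (0 * (1 + del) - del * s ^ 2) / (sigma ^ 2 * (1 + del))))
        by (field; repeat split; lra).
      rewrite exp_plus, e. field. apply Rgt_not_eq, exp_pos.
  - assert (hE := exp_pos (- 2 * r * t)). assert (hx := exp_pos (- r * t)).
    replace (exp (- 2 * r * t) + del * exp (- 2 * r * t))
      with (exp (- 2 * r * t) * (1 + del)) by ring.
    assert (hq := sqrt_lt_R0 _ hd).
    repeat split.
    + apply Rmult_lt_0_compat; assumption.
    + rewrite ln_mult, ln_exp by assumption. field; exact hr.
    + rewrite sqrt_mult, (sqrt_exp_double (- r * t)) by lra. field. split; lra.
    + rewrite sqrt_mult, (sqrt_exp_double (- r * t)) by lra. field. split; lra.
  - rewrite Rmult_1_r; repeat split; ring.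
Qed.

(** For a fixed [del] the invariance of the sum reads
    [sum a_l (exp (l r tau) H_l(y) - M H_l(s)) exp (l r t) = 0] for all [t], where [tau],
    [y] and [M] do not depend on [t].  Independence of the exponentials makes the
    sum of the coefficients at each rate vanish, so the bracket is 0 wherever the
    collected coefficient is not.  The time-shift conjugation carries this identity
    back to arbitrary times. *)
Lemma fixed_sum_fixed_modes r sigma i L nu : r <> 0 -> sigma <> 0 ->
  collected L nu <> 0 ->
  mapped_to_itself r sigma i (fun t s c => c - mode_sum r sigma L t s) ->
  forall eps t s, G_dom r i eps t ->
    exp (IZR nu * r * G_t r i eps t) * mode r sigma nu (G_s r i eps t s)
    = G_c r sigma i eps t s (exp (IZR nu * r * t) * mode r sigma nu s).
Proof.
  intros hr hs hnu hfix eps t0 s hd0.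
  assert (hw := time_weight_pos r i t0).
  set (del := eps / time_weight r i t0).
  assert (heps : eps = del * time_weight r i t0) by (unfold del; field; lra).
  assert (hd : G_dom r i del 0).
  { clear - hd0 hw. unfold del; clear del.
    destruct i; unfold G_dom, time_weight in *; rewrite ?Rmult_0_r, ?exp_0; try exact I.
    - replace (1 + _) with ((exp (2 * r * t0) + eps) / exp (2 * r * t0)) by (field; lra).
      apply Rdiv_lt_0_compat; assumption.
    - replace (1 + _) with ((exp (- 2 * r * t0) + eps) / exp (- 2 * r * t0)) by (field; lra).
      apply Rdiv_lt_0_compat; assumption. }
  set (tau := G_t r i del 0). set (y := G_s r i del 0 s). set (M := G_c r sigma i del 0 s 1).
  set (gap := fun l => exp (IZR l * r * tau) * mode r sigma l y - M * mode r sigma l s).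
  assert (hgap : gap nu = 0).
  { assert (h := exp_sum_separation (snd (A := R) (B := Z)) r nu L hr
                   (fun p => fst p * gap (snd p)) 0).
    cbv beta in h. rewrite Rplus_0_r in h.
    apply (Rmult_eq_reg_l (collected L nu)); [|exact hnu]. rewrite Rmult_0_r.
    etransitivity; [|apply h].
    - unfold collected. symmetry.
      rewrite (lsum_linear (fun p => if Z.eq_dec (snd p) nu then fst p else 0)
                 (fun _ => 0) _ (gap nu) 0); [ring|].
      intros p. destruct (Z.eq_dec (snd p) nu) as [->|]; ring.
    - intros t.
      destruct (time_shift_conjugation r sigma i del t s (mode_sum r sigma L t s) hr hs hd)
        as (h1 & h2 & h3 & h4).
      assert (hm := proj2 (hfix _ t s (mode_sum r sigma L t s) h1)).
      unfold transform in hm. rewrite h2, h3, h4, G_c_factor in hm.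
      fold M y tau in hm.
      rewrite (lsum_linear
        (fun p => fst p * (exp (IZR (snd p) * r * (t + tau)) * mode r sigma (snd p) y))
        (fun p => fst p * (exp (IZR (snd p) * r * t) * mode r sigma (snd p) s)) _ 1 (- M)).
      + fold (mode_sum r sigma L (t + tau) y) (mode_sum r sigma L t s).
        rewrite Rmult_0_l, Rplus_0_r. assert (hm' := hm ltac:(ring)). lra.
      + intros p. unfold gap. rewrite !Rmult_plus_distr_l, exp_plus. ring. }
  destruct (time_shift_conjugation r sigma i del t0 s
              (exp (IZR nu * r * t0) * mode r sigma nu s) hr hs hd) as (h1 & h2 & h3 & h4).
  rewrite <- heps in *. rewrite h2, h3, h4, G_c_factor. fold M y tau.
  unfold gap in hgap. rewrite Rmult_plus_distr_l, exp_plus.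
  replace (M * _) with (exp (IZR nu * r * t0) * (M * mode r sigma nu s)) by ring.
  replace (M * mode r sigma nu s) with (exp (IZR nu * r * tau) * mode r sigma nu y) by lra.
  ring.
Qed.

(** * Generators annihilate invariant modes *)

(** [G_4] and [G_5] are the flows of [- xi_4] and [- xi_5]. *)
Definition flow_sign (i : symmetry) : R :=
  match i with sym4 | sym5 => -1 | _ => 1 end.

Lemma G_dom_near_0 r i t : locally 0 (fun eps => G_dom r i eps t).
Proof.
  assert (h : forall x, locally 0 (fun eps => 0 < exp x + eps)).
  { intros x. exists (mkposreal _ (exp_pos x)). intros y hy.
    unfold ball in hy; simpl in hy; unfold AbsRing_ball, abs, minus, plus, opp in hy; simpl in hy.
    apply Rabs_def2 in hy. lra. }
  destruct i; unfold G_dom; try apply h; apply filter_forall; intros; exact I.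
Qed.

Lemma G_at_zero r i t s : r <> 0 ->
  G_t r i 0 t = t /\ G_s r i 0 t s = s.
Proof.
  intros hr.
  assert (h2 : 2 * r <> 0) by lra.
  destruct i; unfold G_t, G_s; rewrite ?Rplus_0_r, ?ln_exp; split; try ring; try (field; assumption).
  - rewrite (sqrt_exp_double (r * t)) by ring. field. apply Rgt_not_eq, exp_pos.
  - rewrite (sqrt_exp_double (- r * t)) by ring. field. apply Rgt_not_eq, exp_pos.
Qed.

Lemma flow_generator r sigma i t s c : r <> 0 -> sigma <> 0 ->
  is_derive (fun eps => G_t r i eps t) 0 (flow_sign i * xi_t r i t)
  /\ is_derive (fun eps => G_s r i eps t s) 0 (flow_sign i * xi_s r i t s)
  /\ is_derive (fun eps => G_c r sigma i eps t s c) 0 (flow_sign i * xi_c r sigma i t s c).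
Proof.
  intros hr hs.
  set (x := exp (r * t)).
  assert (hx : 0 < x) by apply exp_pos.
  assert (hxi : exp (- r * t) = / x)
    by (unfold x; rewrite <- exp_Ropp; f_equal; ring).
  assert (h2 : exp (2 * r * t) = x * x) by (apply exp_sqr; ring).
  assert (h2i : exp (- 2 * r * t) = / x * / x) by (rewrite <- hxi; apply exp_sqr; ring).
  assert (hq : sqrt (x * x + 0) = x) by (rewrite Rplus_0_r; apply sqrt_square; lra).
  assert (hxx : 0 < x * x) by (apply Rmult_lt_0_compat; exact hx).
  assert (hix : 0 < / x) by (apply Rinv_0_lt_compat; exact hx).
  assert (hixx : 0 < / x * / x) by (apply Rmult_lt_0_compat; exact hix).
  assert (hqi : sqrt (/ x * / x + 0) = / x) by (rewrite Rplus_0_r; apply sqrt_square; lra).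
  assert (hss : 0 < sigma * (sigma * 1))
    by (change (0 < sigma ^ 2); apply pow2_gt_0; exact hs).
  unfold flow_sign; destruct i; unfold G_t, G_s, G_c, xi_t, xi_s, xi_c;
    rewrite ?h2, ?h2i, ?hxi; fold x; (split; [|split]).
  - auto_derive; [exact I|ring].
  - auto_derive; [exact I|ring].
  - auto_derive; [exact I|ring].
  - auto_derive; [exact I|ring].
  - auto_derive; [exact I|fold x; ring].
  - auto_derive; [exact I|ring].
  - auto_derive; [exact I|ring].
  - auto_derive; [exact I|ring].
  - auto_derive; [exact I|]. simpl pow. rewrite !Rmult_0_l, Ropp_0, exp_0. field; lra.
  - auto_derive; [lra|]. field; lra.
  - auto_derive; [rewrite hq; derive_side; lra|]. rewrite hq. field; lra.
  - auto_derive; [assert (0 < sigma * (sigma * 1) * (x * x + 0))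
                    by (apply Rmult_lt_0_compat; lra); lra|].
    simpl pow. set (L := - (_ * / _)).
    (* at [eps = 0] the exponent is [- 2 r t] *)
    assert (hL : exp L = / x * / x).
    { rewrite <- h2i. f_equal. unfold L. field; lra. }
    rewrite hL. field; lra.
  - auto_derive; [lra|]. field; lra.
  - auto_derive; [rewrite hqi; derive_side; lra|]. rewrite hqi. field; lra.
  - auto_derive; [rewrite hqi; derive_side; lra|]. rewrite hqi. field; lra.
  - auto_derive; [exact I|ring].
  - auto_derive; [exact I|ring].
  - auto_derive; [exact I|rewrite exp_0; ring].
Qed.

(** Along the flow, [f (G_t, G_s) = G_c (f)].  The derivatives of the two sides at
    parameter 0 are, up to the common sign, [xi_t f_t + xi_s f_s] and [xi_c], and the
    difference of these is [xi_i (c - f)]. *)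
Lemma fixed_sum_generator_zero r sigma i L nu f t s : r <> 0 -> sigma <> 0 ->
  collected L nu <> 0 ->
  (forall t s, f t s = exp (IZR nu * r * t) * mode r sigma nu s) ->
  mapped_to_itself r sigma i (fun t s c => c - mode_sum r sigma L t s) ->
  xi_app r sigma i (fun t s c => c - f t s) t s (f t s) = 0.
Proof.
  intros hr hs hnu hf hfix.
  destruct (mode_ode r sigma nu hs) as [H1 hH]. destruct (hH s) as [dH _].
  set (H := mode r sigma nu) in *.
  destruct (flow_generator r sigma i t s (f t s) hr hs) as (dT & dS & dC).
  destruct (G_at_zero r i t s hr) as [T0 S0].
  set (T := fun eps => G_t r i eps t) in *. set (S := fun eps => G_s r i eps t s) in *.
  set (k := IZR nu * r).
  assert (dF : is_derive (fun eps => exp (k * T eps) * H (S eps)) 0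
    (k * (flow_sign i * xi_t r i t) * exp (k * t) * H s
     + exp (k * t) * (flow_sign i * xi_s r i t s * H1 s))).
  { assert (DT := is_derive_unique _ _ _ dT).
    change (Derive (fun eps => T eps) 0 = flow_sign i * xi_t r i t) in DT.
    assert (dHS : is_derive (fun eps => H (S eps)) 0 (flow_sign i * xi_s r i t s * H1 s)).
    { apply (is_derive_comp H S 0); [|exact dS].
      change (G_s r i 0 t s) with (S 0) in S0. rewrite S0. exact dH. }
    set (HS := fun eps => H (S eps)) in *.
    assert (DHS := is_derive_unique _ _ _ dHS).
    change (Derive (fun eps => HS eps) 0 = flow_sign i * xi_s r i t s * H1 s) in DHS.
    change (is_derive (fun eps => exp (k * T eps) * HS eps) 0
      (k * (flow_sign i * xi_t r i t) * exp (k * t) * H s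
       + exp (k * t) * (flow_sign i * xi_s r i t s * H1 s))).
    auto_derive; [derive_side|]. rewrite DT, DHS. unfold HS.
    change (G_t r i 0 t) with (T 0) in T0. change (G_s r i 0 t s) with (S 0) in S0.
    rewrite T0, S0. ring. }
  assert (dF' : is_derive (fun eps => exp (k * T eps) * H (S eps)) 0
    (flow_sign i * xi_c r sigma i t s (f t s))).
  { refine (is_derive_ext_loc _ _ _ _ _ dC).
    apply (filter_imp (fun eps => G_dom r i eps t)); [|apply G_dom_near_0].
    intros eps he. rewrite hf. symmetry.
    exact (fixed_sum_fixed_modes r sigma i L nu hr hs hnu hfix eps t s he). }
  assert (e := is_derive_unique _ _ _ dF). rewrite (is_derive_unique _ _ _ dF') in e.
  unfold xi_app.
  assert (Dt : Derive (fun t' : R => f t s - f t' s) t = - (k * exp (k * t) * H s)).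
  { apply is_derive_unique.
    apply (is_derive_ext (fun t' => f t s - exp (k * t') * H s));
      [intros t'; rewrite (hf t' s); reflexivity|].
    auto_derive; [exact I|ring]. }
  assert (Ds : Derive (fun s' : R => f t s - f t s') s = - (exp (k * t) * H1 s)).
  { apply is_derive_unique.
    apply (is_derive_ext (fun s' => f t s - exp (k * t) * H s'));
      [intros s'; rewrite (hf t s'); reflexivity|].
    assert (DH := is_derive_unique _ _ _ dH).
    change (Derive (fun x => H x) s = H1 s) in DH.
    auto_derive; [derive_side|]. rewrite DH. ring. }
  assert (Dc : Derive (fun c' : R => c' - f t s) (f t s) = 1)
    by (apply is_derive_unique; auto_derive; [exact I|ring]).
  rewrite Dt, Ds, Dc.
  apply (Rmult_eq_reg_l (flow_sign i)); [|destruct i; simpl; lra].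
  rewrite Rmult_0_r. etransitivity; [|exact (Rminus_diag_eq _ _ e)]. ring.
Qed.

(** * Collected coefficients *)

Lemma net_coef_collected K (a : nat -> R) (nu rate : nat -> Z) n l :
  (forall k, (1 <= k <= K)%nat -> rate k = l <-> nu k = n) ->
  collected (map (fun k => (a k, rate k)) (seq 1 K)) l = net_coef K a nu n.
Proof.
  intros h. symmetry. apply sum_n_m_lsum. intros k hk; simpl.
  specialize (h k hk).
  destruct (Z.eq_dec (nu k) n), (Z.eq_dec (rate k) l); tauto.
Qed.

Lemma collected_absent K (a : nat -> R) (rate : nat -> Z) l :
  (forall k, (1 <= k <= K)%nat -> rate k <> l) ->
  collected (map (fun k => (a k, rate k)) (seq 1 K)) l = 0.
Proof.
  intros h. unfold collected.
  rewrite <- (sum_n_m_lsum (fun k => (a k, rate k))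
    (fun p => if Z.eq_dec (snd p) l then fst p else 0) (fun _ => 0)).
  - apply (sum_n_m_const_zero (G := R_AbelianMonoid)).
  - intros k hk; simpl. destruct (Z.eq_dec (rate k) l); [destruct (h k hk); assumption|reflexivity].
Qed.

Theorem corollary2
  (r sigma : R) (hr : r <> 0) (hsigma : sigma <> 0)
  (K1 K2 K3 K4 : nat)
  (hK1 : (1 <= K1)%nat) (hK2 : (1 <= K2)%nat) (hK3 : (1 <= K3)%nat) (hK4 : (1 <= K4)%nat)
  (m z w d : nat -> R)
  (mu zeta omega delta : nat -> Z)
  (hmu : forall k, (1 <= k <= K1)%nat -> nonpos_even (mu k))
  (hzeta : forall k, (1 <= k <= K2)%nat -> nonpos_even (zeta k))
  (homega : forall k, (1 <= k <= K3)%nat -> nonpos_even (omega k))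
  (hdelta : forall k, (1 <= k <= K4)%nat -> nonpos_even (delta k))
  (i : symmetry)
  (* [f] is one of the functions in the sum, [a] its total coefficient there *)
  (f : R -> R -> R) (a : R)
  (hf : (exists k, (1 <= k <= K1)%nat /\
           f = C1 r sigma (mu k) /\ a = net_coef K1 m mu (mu k))
     \/ (exists k, (1 <= k <= K2)%nat /\
           f = C2 r sigma (zeta k) /\ a = net_coef K2 z zeta (zeta k))
     \/ (exists k, (1 <= k <= K3)%nat /\
           f = C3 r sigma (omega k) /\ a = net_coef K3 w omega (omega k))
     \/ (exists k, (1 <= k <= K4)%nat /\
           f = C4 r sigma (delta k) /\ a = net_coef K4 d delta (delta k)))
  (hxi : xi_nonzero_on_surface r sigma i (fun t s c => c - f t s)) :
  let Csum := fun t s =>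
    sum_n_m (fun k => m k * C1 r sigma (mu k) t s) 1 K1
    + sum_n_m (fun k => z k * C2 r sigma (zeta k) t s) 1 K2
    + sum_n_m (fun k => w k * C3 r sigma (omega k) t s) 1 K3
    + sum_n_m (fun k => d k * C4 r sigma (delta k) t s) 1 K4 in
  let Phi := fun t s c => c - Csum t s in
  is_solution r sigma (fun _ => True) Phi
  /\ mapped_to_elementary_solutions r sigma i Phi
  /\ (a <> 0 -> mapped_to_one_parameter_elementary_family r sigma i Phi)
  /\ (forall eps t s c, G_dom r i eps t ->
        (transform r sigma i eps Phi t s c = 0 <->
         G_c r sigma i eps t s c =
           sum_n_m (fun k => m k * C1 r sigma (mu k) (G_t r i eps t) (G_s r i eps t s)) 1 K1
           + sum_n_m (fun k => z k * C2 r sigma (zeta k) (G_t r i eps t) (G_s r i eps t s)) 1 K2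
           + sum_n_m (fun k => w k * C3 r sigma (omega k) (G_t r i eps t) (G_s r i eps t s)) 1 K3
           + sum_n_m (fun k => d k * C4 r sigma (delta k) (G_t r i eps t) (G_s r i eps t s)) 1 K4)).
Proof.
  intros Csum Phi.
  set (L1 := map (fun k => (m k, mu k)) (seq 1 K1)).
  set (L2 := map (fun k => (z k, zeta k + 1)%Z) (seq 1 K2)).
  set (L3 := map (fun k => (w k, 3 - omega k)%Z) (seq 1 K3)).
  set (L4 := map (fun k => (d k, 2 - delta k)%Z) (seq 1 K4)).
  set (L := L1 ++ L2 ++ L3 ++ L4).
  assert (hC : forall t s, Csum t s = mode_sum r sigma L t s).
  { intros t s. unfold Csum, mode_sum, L. rewrite !lsum_app, <- !Rplus_assoc.
    f_equal; [f_equal; [f_equal|]|]; apply sum_n_m_lsum; intros k hk; simpl; f_equal.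
    - apply C1_mode; auto.
    - apply C2_mode; auto.
    - apply C3_mode; auto.
    - apply C4_mode; auto. }
  assert (hPhi : Phi = fun t s c => c - mode_sum r sigma L t s).
  { unfold Phi. apply functional_extensionality; intros t.
    apply functional_extensionality; intros s.
    rewrite hC. reflexivity. }
  assert (hmap : forall j, mapped_to_elementary_solutions r sigma j Phi)
    by (intros j; rewrite hPhi; apply mode_sum_mapped; assumption).
  split; [|split; [|split]].
  - (* the solution is its own transform under [G_1] with parameter 0 *)
    destruct (hmap sym1 0) as (u & hu & sol & _). exists u. split; [|exact sol].
    intros t s c ht. rewrite <- (hu t s c ht). unfold transform; simpl.
    rewrite Rplus_0_r. reflexivity.
  - apply hmap.
  - intros ha. split; [apply hmap|]. rewrite hPhi. intros hfix.
    assert (hnu : exists nu, collected L nu = a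
              /\ forall t s, f t s = exp (IZR nu * r * t) * mode r sigma nu s).
    { (* no two families share a rate, so only the family of [f] contributes *)
      assert (happ : forall l, collected L l
         = collected L1 l + (collected L2 l + (collected L3 l + collected L4 l)))
        by (intros l; unfold collected, L; rewrite !lsum_app; reflexivity).
      destruct hf as [(k & hk & -> & ->)|[(k & hk & -> & ->)|[(k & hk & -> & ->)|(k & hk & -> & ->)]]].
      - destruct (hmu k hk) as [p hp].
        exists (mu k). split; [|intros; apply C1_mode; auto].
        rewrite happ.
        rewrite (net_coef_collected K1 m mu mu (mu k)) by (intros; lia).
        unfold L2, L3, L4. rewrite !collected_absent; [ring|..]; intros k' hk'.
        + destruct (hdelta k' hk') as [p' ->]; lia.
        + destruct (homega k' hk') as [p' ->]; lia.
        + destruct (hzeta k' hk') as [p' ->]; lia.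
      - destruct (hzeta k hk) as [p hp].
        exists (zeta k + 1)%Z. split; [|intros; apply C2_mode; auto].
        rewrite happ.
        rewrite (net_coef_collected K2 z zeta (fun k => zeta k + 1)%Z (zeta k)) by (intros; lia).
        unfold L1, L3, L4. rewrite !collected_absent; [ring|..]; intros k' hk'.
        + destruct (hdelta k' hk') as [p' ->]; lia.
        + destruct (homega k' hk') as [p' ->]; lia.
        + destruct (hmu k' hk') as [p' ->]; lia.
      - destruct (homega k hk) as [p hp].
        exists (3 - omega k)%Z. split; [|intros; apply C3_mode; auto].
        rewrite happ.
        rewrite (net_coef_collected K3 w omega (fun k => 3 - omega k)%Z (omega k)) by (intros; lia).
        unfold L1, L2, L4. rewrite !collected_absent; [ring|..]; intros k' hk'.
        + destruct (hdelta k' hk') as [p' ->]; lia.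
        + destruct (hzeta k' hk') as [p' ->]; lia.
        + destruct (hmu k' hk') as [p' ->]; lia.
      - destruct (hdelta k hk) as [p hp].
        exists (2 - delta k)%Z. split; [|intros; apply C4_mode; auto].
        rewrite happ.
        rewrite (net_coef_collected K4 d delta (fun k => 2 - delta k)%Z (delta k)) by (intros; lia).
        unfold L1, L2, L3. rewrite !collected_absent; [ring|..]; intros k' hk'.
        + destruct (homega k' hk') as [p' ->]; lia.
        + destruct (hzeta k' hk') as [p' ->]; lia.
        + destruct (hmu k' hk') as [p' ->]; lia. }
    destruct hnu as (nu & hcoll & hfm).
    destruct hxi as (t & s & c & hsurf & hne). apply hne.
    replace c with (f t s) by lra.
    apply (fixed_sum_generator_zero r sigma i L nu); auto. rewrite hcoll; exact ha.
  - intros eps t s c _. unfold transform, Phi, Csum. split; intros h; lra.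
Qed.
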